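(* Suppose each $f_i$ is strongly convex with constant $\mu_i>0$, $i=1,\dots,m$; let $\mu=\min_i\mu_i$ and $L_h=(1/\mu)(2+2\cos(\pi/m))$. Let $h=-g$ and let $\boldsymbol{\lambda}^\star$ be a dual optimal solution, i.e. a maximizer of $g$ over $\mathbb{R}^{n(m-1)}$. Let $\{\boldsymbol{\lambda}^{(k)}\}_{k\ge0}$ be generated by the inexact dual algorithm with distortions satisfying $\|\mathbf{r}_i^{(k)}\|\le\varepsilon_i$ for all $i,k$ and with stepsizes satisfying $0<\gamma_k\le1/L_h$ for all $k\ge0$. Then for every $k\ge0$, $$\min_{i\in\{0,\dots,k\}}\|\nabla h(\boldsymbol{\lambda}^{(i)})\|\le\sqrt{\frac{2\left(h(\boldsymbol{\lambda}^{(0)})-h(\boldsymbol{\lambda}^\star)\right)}{\sum_{i=0}^{k}\gamma_i}}+\epsilon .$$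
   Context: Let $m\ge2$, $n\ge1$ be integers, $\mathcal{Y}\subseteq\mathbb{R}^n$ a nonempty closed convex set, and $f_i:\mathbb{R}^n\to\mathbb{R}$, $i=1,\dots,m$, strictly convex closed functions. For $\mathbf{y}=(\mathbf{y}_1,\dots,\mathbf{y}_m)\in(\mathbb{R}^n)^m=\mathbb{R}^{nm}$ put $f(\mathbf{y})=\sum_{i=1}^m f_i(\mathbf{y}_i)$, let $\bar{\mathcal{Y}}=\mathcal{Y}^m$, and $\mathbf{A}\mathbf{y}=(\mathbf{y}_1-\mathbf{y}_2,\dots,\mathbf{y}_{m-1}-\mathbf{y}_m)\in\mathbb{R}^{n(m-1)}$. The dual function is $g(\boldsymbol{\lambda})=\inf_{\mathbf{y}\in\bar{\mathcal{Y}}}\big[f(\mathbf{y})+\boldsymbol{\lambda}^{T}\mathbf{A}\mathbf{y}\big]$, $\boldsymbol{\lambda}\in\mathbb{R}^{n(m-1)}$; when all $f_i$ are strongly convex, $g$ is differentiable. Inexact dual algorithm: start from any $\boldsymbol{\lambda}^{(0)}\in\mathbb{R}^{n(m-1)}$; for $k=0,1,2,\dots$ let $\mathbf{y}^{(k)}=\arg\min_{\mathbf{y}\in\bar{\mathcal{Y}}}\big[f(\mathbf{y})+(\boldsymbol{\lambda}^{(k)})^{T}\mathbf{A}\mathbf{y}\big]$, let $\hat{\mathbf{y}}_i^{(k)}=\mathbf{y}_i^{(k)}+\mathbf{r}_i^{(k)}$ where $\mathbf{r}_i^{(k)}\in\mathbb{R}^n$ are arbitrary distortions, let $\hat{\mathbf{d}}^{(k)}=\mathbf{A}\hat{\mathbf{y}}^{(k)}$,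 and set $\boldsymbol{\lambda}^{(k+1)}=\boldsymbol{\lambda}^{(k)}+\gamma_k\hat{\mathbf{d}}^{(k)}$. The distortions are bounded by constants: $\|\mathbf{r}_i^{(k)}\|\le\varepsilon_i$ for all $i$ and $k$, and $\epsilon:=\sqrt{\sum_{i=1}^{m-1}(\varepsilon_i+\varepsilon_{i+1})^2}$. Norms are Euclidean. A function $\varphi$ is strongly convex with constant $\sigma>0$ if $\varphi-\frac{\sigma}{2}\|\cdot\|^2$ is convex. *)

(* Defs.v *)
(* Vectors of R^n are rows 'rV[R]_n.  The stacked
   vectors y = (y_1, ..., y_m) of (R^n)^m and lambda of R^(n(m-1)) are the
   matrices 'M[R]_(m, n) and 'M[R]_(m.-1, n), whose i-th row is the i-th block;
   block indices start at 0. *)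
From HB Require Import structures.
From mathcomp Require Import all_boot all_order all_algebra.
From mathcomp Require Import all_classical all_reals all_analysis.
Set Implicit Arguments.
Unset Strict Implicit.
Unset Printing Implicit Defensive.
Import Order.TTheory GRing.Theory Num.Theory.
Import numFieldNormedType.Exports.
Local Open Scope classical_set_scope.
Local Open Scope ring_scope.

(* The library norm `|x| on matrices is the sup norm. *)
Definition dotmx (R : realType) (p q : nat) (x y : 'M[R]_(p, q)) : R :=
  \sum_(i < p) \sum_(j < q) x i j * y i j.

Definition enorm (R : realType) (p q : nat) (x : 'M[R]_(p, q)) : R :=
  Num.sqrt (dotmx x x).

Definition gradient (R : realType) (p q : nat) (h : 'M[R]_(p, q) -> R)
    (x : 'M[R]_(p, q)) : 'M[R]_(p, q) :=
  \matrix_(i < p, j < q) 'D_(delta_mx i j) (h : 'M[R]_(p, q) -> R^o) x.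

Definition strictly_convex (R : realType) (n : nat) (f : 'rV[R]_n -> R) : Prop :=
  forall (x y : 'rV[R]_n) (t : R), x != y -> 0 < t < 1 ->
    f (t *: x + (1 - t) *: y) < t * f x + (1 - t) * f y.

Definition strongly_convex (R : realType) (n : nat) (sigma : R)
    (f : 'rV[R]_n -> R) : Prop :=
  convex_function setT
    (fun x : 'rV[R]_n => f x - sigma / 2 * enorm x ^+ 2 : R^o).

Definition closed_function (R : realType) (n : nat) (f : 'rV[R]_n -> R) : Prop :=
  closed [set p : 'rV[R]_n * R | f p.1 <= p.2].

Definition argmin (R : realType) (T : Type) (D : set T) (F : T -> R) : set T :=
  [set x | D x /\ forall z, D z -> F x <= F z].

Definition minI (R : realType) (k : nat) (k_gt0 : (0 < k)%N)
    (F : 'I_k -> R) : R :=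
  \big[Num.min/F (Ordinal k_gt0)]_(i < k) F i.

Lemma next_subproof (m : nat) (i : 'I_m.-1) : (i.+1 < m)%N.
Proof. by rewrite -ltn_predRL. Qed.

(* For i < m - 1, the indices i and i + 1 as elements of 'I_m. *)
Definition this (m : nat) (i : 'I_m.-1) : 'I_m := widen_ord (leq_pred m) i.
Definition next (m : nat) (i : 'I_m.-1) : 'I_m := Ordinal (next_subproof i).

(* The operator A of the constraints y_i = y_(i+1). *)
Definition chain_diff (R : realType) (m n : nat) (y : 'M[R]_(m, n)) :
    'M[R]_(m.-1, n) :=
  \matrix_(i < m.-1, j < n) (y (this i) j - y (next i) j).

Definition prodset (R : realType) (m n : nat) (Y : set 'rV[R]_n) :
    set 'M[R]_(m, n) :=
  [set y | forall i : 'I_m, Y (row i y)].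

Definition lagrangian (R : realType) (m n : nat) (f : 'I_m -> 'rV[R]_n -> R)
    (lam : 'M[R]_(m.-1, n)) (y : 'M[R]_(m, n)) : R :=
  \sum_(i < m) f i (row i y) + dotmx lam (chain_diff y).

Definition dual (R : realType) (m n : nat) (Y : set 'rV[R]_n)
    (f : 'I_m -> 'rV[R]_n -> R) (lam : 'M[R]_(m.-1, n)) : \bar R :=
  ereal_inf [set (lagrangian f lam y)%:E | y in prodset Y].

(* h = - g, read in R: the dual function is finite everywhere when the f_i are
   strongly convex and Y is nonempty. *)
Definition neg_dual (R : realType) (m n : nat) (Y : set 'rV[R]_n)
    (f : 'I_m -> 'rV[R]_n -> R) (lam : 'M[R]_(m.-1, n)) : R :=
  - fine (dual Y f lam).

Definition dual_optimal (R : realType) (m n : nat) (Y : set 'rV[R]_n)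
    (f : 'I_m -> 'rV[R]_n -> R) (lam : 'M[R]_(m.-1, n)) : Prop :=
  forall lam', (dual Y f lam' <= dual Y f lam)%E.

(* The sequences lam (arbitrary lam 0) and y are generated by the inexact dual
   algorithm with stepsizes gam and distortions r, row i of r k being r_i^(k). *)
Definition inexact_dual (R : realType) (m n : nat) (Y : set 'rV[R]_n)
    (f : 'I_m -> 'rV[R]_n -> R) (gam : nat -> R) (r : nat -> 'M[R]_(m, n))
    (lam : nat -> 'M[R]_(m.-1, n)) (y : nat -> 'M[R]_(m, n)) : Prop :=
  forall k : nat,
    argmin (prodset Y) (lagrangian f (lam k)) (y k) /\
    lam k.+1 = lam k + gam k *: chain_diff (y k + r k).

(* Lipschitz constant of the gradient of h, for mu_i the strong convexity
   constant of f_i: 2 + 2 cos (pi / m) is the largest eigenvalue of A A^T. *)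
Definition Lh (R : realType) (m : nat) (m_gt0 : (0 < m)%N) (mu : 'I_m -> R) : R :=
  (1 / minI m_gt0 mu) * (2 + 2 * cos (pi / m%:R)).

Definition total_distortion (R : realType) (m : nat) (eps : 'I_m -> R) : R :=
  Num.sqrt (\sum_(i < m.-1) (eps (this i) + eps (next i)) ^+ 2).

(* Main.v *)
(* If y minimizes the Lagrangian at lam over Y^m, strong convexity makes it grow
   by mu/2 |z - y|^2 at every feasible z.  Since |A^T d|^2 <= (2 + 2 cos(pi/m)) |d|^2,
   this gives, with h = -g,
     0 <= h(lam + d) - h(lam) + <d, A y> <= L_h/2 |d|^2   for all d.
   Hence g is finite, grad h(lam) = - A y, and with d = gamma (A y + A r) and
   gamma L_h <= 1,
     gamma/2 (|grad h(lam)|^2 - |A r|^2) <= h(lam) - h(lam + d).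
   Sum over the iterations, use |A r| <= epsilon and sqrt (a + b) <= sqrt a + sqrt b. *)
Require Import Defs.
From HB Require Import structures.
From mathcomp Require Import all_boot all_order all_algebra.
From mathcomp Require Import all_classical all_reals all_analysis.
From mathcomp Require Import ring lra.
Set Implicit Arguments.
Unset Strict Implicit.
Unset Printing Implicit Defensive.
Import Order.TTheory GRing.Theory Num.Theory.
Import numFieldNormedType.Exports.
Local Open Scope classical_set_scope.
Local Open Scope ring_scope.

(* MathComp's spectral.v also exports a [dotmx]. *)
Local Notation dotmx := Defs.dotmx.

Section Dotmx.
Variables (R : realType) (p q : nat).
Implicit Types (x y z : 'M[R]_(p, q)) (a b : R).

Lemma dotmxC x y : dotmx x y = dotmx y x.
Proof. by do 2![apply: eq_bigr => ? _]; rewrite mulrC. Qed.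

Lemma dotmxDl x y z : dotmx (x + y) z = dotmx x z + dotmx y z.
Proof.
rewrite -big_split; apply: eq_bigr => i _; rewrite -big_split.
by apply: eq_bigr => j _; rewrite mxE mulrDl.
Qed.

Lemma dotmxZl a x y : dotmx (a *: x) y = a * dotmx x y.
Proof.
rewrite /dotmx mulr_sumr; apply: eq_bigr => i _; rewrite mulr_sumr.
by apply: eq_bigr => j _; rewrite mxE mulrA.
Qed.

Lemma dotmxDr x y z : dotmx z (x + y) = dotmx z x + dotmx z y.
Proof. by rewrite dotmxC dotmxDl !(dotmxC z). Qed.

Lemma dotmxZr a x y : dotmx y (a *: x) = a * dotmx y x.
Proof. by rewrite dotmxC dotmxZl dotmxC. Qed.

Lemma dotmxNl x y : dotmx (- x) y = - dotmx x y.
Proof. by rewrite -scaleN1r dotmxZl mulN1r. Qed.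

Lemma dotmxNr x y : dotmx y (- x) = - dotmx y x.
Proof. by rewrite dotmxC dotmxNl dotmxC. Qed.

Definition dotmxE :=
  (dotmxDl, dotmxDr, dotmxZl, dotmxZr, dotmxNl, dotmxNr).

Lemma dotmx_ge0 x : 0 <= dotmx x x.
Proof. by do 2![apply: sumr_ge0 => ? _]; rewrite -expr2 sqr_ge0. Qed.

Lemma sqr_enorm x : enorm x ^+ 2 = dotmx x x.
Proof. by rewrite sqr_sqrtr ?dotmx_ge0. Qed.

Lemma enorm_ge0 x : 0 <= enorm x.
Proof. exact: sqrtr_ge0. Qed.

Lemma enorm_le x a : 0 <= a -> (enorm x <= a) = (dotmx x x <= a ^+ 2).
Proof. by move=> a0; rewrite -sqr_enorm ler_sqr ?nnegrE ?enorm_ge0. Qed.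

Lemma enormN x : enorm (- x) = enorm x.
Proof. by rewrite /enorm !dotmxE opprK. Qed.

Lemma dotmx_sum_row x y : dotmx x y = \sum_(i < p) dotmx (row i x) (row i y).
Proof.
apply: eq_bigr => i _; rewrite /dotmx big_ord1.
by apply: eq_bigr => j _; rewrite !mxE.
Qed.

Lemma dotmx_delta x i j : dotmx (delta_mx i j) x = x i j.
Proof.
rewrite /dotmx (bigD1 i)//= [X in _ + X]big1 => [|k ki].
  rewrite addr0 (bigD1 j)//= big1 ?addr0 => [|l lj].
    by rewrite mxE !eqxx mul1r.
  by rewrite mxE (negbTE lj) andbF mul0r.
by rewrite big1// => l _; rewrite mxE (negbTE ki) mul0r.
Qed.

Lemma dotmx_eq0 x : dotmx x x = 0 -> x = 0.
Proof.
have sq_ge0 i j : 0 <= x i j * x i j by rewrite -expr2 sqr_ge0.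
move/psumr_eq0P => x0; apply/matrixP => i j; rewrite mxE.
have /psumr_eq0P/(_ j isT)/eqP : \sum_(j < q) x i j * x i j = 0.
  by apply: x0 => // k _; exact: sumr_ge0.
by rewrite mulf_eq0 orbb => H; apply/eqP/H.
Qed.

Lemma dotmx_le_enorm x y : dotmx x y <= enorm x * enorm y.
Proof.
have [/dotmx_eq0 -> | x0] := eqVneq (dotmx x x) 0.
  by rewrite -(scale0r 0) dotmxZl mul0r mulr_ge0 ?enorm_ge0.
have [/dotmx_eq0 -> | y0] := eqVneq (dotmx y y) 0.
  by rewrite -(scale0r 0) dotmxZr mul0r mulr_ge0 ?enorm_ge0.
have {}x0 : 0 < enorm x by rewrite sqrtr_gt0 lt_def x0 dotmx_ge0.
have {}y0 : 0 < enorm y by rewrite sqrtr_gt0 lt_def y0 dotmx_ge0.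
have := dotmx_ge0 (enorm y *: x - enorm x *: y).
rewrite !dotmxE -!sqr_enorm (dotmxC y x) => H.
rewrite -subr_ge0 -(pmulr_rge0 _ (mulr_gt0 x0 y0)); lra.
Qed.

Lemma enormB x y : enorm (x - y) <= enorm x + enorm y.
Proof.
rewrite enorm_le ?addr_ge0 ?enorm_ge0//.
have := dotmx_le_enorm (- x) y; rewrite enormN dotmxNl => H.
rewrite !dotmxE (dotmxC y x) sqrrD !sqr_enorm; lra.
Qed.
End Dotmx.

Lemma path_step (R : realFieldType) (mu c t u d e z w : R) : 0 < mu -> 0 < t ->
  (1 + t) * d ^+ 2 / (2 * mu) <= u + d * z ->
  (1 + (2 * c - t^-1)) * e ^+ 2 / (2 * mu) <=
  u + ((1 / mu) * (2 + 2 * c) / 2 * e ^+ 2 + e * (z - w) + mu / 2 * z ^+ 2)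
    + e * w.
Proof.
move=> mu0 t0 H; rewrite -subr_ge0.
set X := (X in 0 <= X).
have -> : X = u + d * z - (1 + t) * d ^+ 2 / (2 * mu) +
   ((mu * z + e - d) ^+ 2 + t * (d + e / t) ^+ 2) / (2 * mu).
  by rewrite /X; field; rewrite !gt_eqF.
apply: addr_ge0; first by rewrite subr_ge0.
apply: divr_ge0; last by rewrite mulr_ge0 ?ltW.
by rewrite addr_ge0 ?sqr_ge0// mulr_ge0 ?sqr_ge0// ltW.
Qed.

Lemma sin_rec (R : realType) (a x : R) :
  sin (x + a + a) = 2 * cos a * sin (x + a) - sin x.
Proof.
have -> : sin x = sin ((x + a) - a) by rewrite addrK.
by rewrite sinB (sinD (x + a)); ring.
Qed.

(* (sin (j pi/(n+2)))_j is the top eigenvector of the path; the ratios t of its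
   consecutive entries are the pivots of the elimination of z_0, d_0, z_1, ..., and
   the last one vanishes because sin pi = 0. *)
Lemma path_form_ge0 (R : realType) (n : nat) (mu : R) (d z : nat -> R) :
  0 < mu ->
  0 <= \sum_(i < n.+1) ((1 / mu) * (2 + 2 * cos (pi / n.+2%:R)) / 2 * d i ^+ 2
         + d i * (z i - z i.+1))
       + mu / 2 * \sum_(i < n.+2) z i ^+ 2.
Proof.
move=> mu0; set a : R := pi / n.+2%:R; set c := cos a.
have sg k : (0 < k < n.+2)%N -> 0 < sin (k%:R * a).
  move=> /andP[k0 kn]; apply: sin_gt0_pi.
  rewrite mulr_gt0 ?ltr0n//= ?divr_gt0 ?pi_gt0 ?ltr0n//.
  by rewrite mulrCA gtr_pMr ?pi_gt0// ltr_pdivrMr ?ltr0n// mul1r ltr_nat.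
have sr k : sin (k.+2%:R * a) = 2 * c * sin (k.+1%:R * a) - sin (k%:R * a).
  have -> : k.+2%:R * a = k%:R * a + a + a by rewrite -!natr1; ring.
  by rewrite sin_rec -[k.+1%:R]natr1 [(_ + 1) * a]mulrDl mul1r.
pose t k := sin (k.+2%:R * a) / sin (k.+1%:R * a).
have inv k : (k <= n)%N ->
    (1 + t k) * d k ^+ 2 / (2 * mu) <=
    \sum_(i < k.+1) ((1 / mu) * (2 + 2 * c) / 2 * d i ^+ 2 + d i * (z i - z i.+1)
        + mu / 2 * z i ^+ 2) + d k * z k.+1.
  elim: k => [_|k IH kn].
    have -> : t 0%N = 2 * c.
      rewrite /t sr mul0r sin0 subr0 mulfK// gt_eqF// sg//.
    rewrite big_ord1 -subr_ge0; set X := (X in 0 <= X).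
    have -> : X = (mu * z 0%N + d 0%N) ^+ 2 / (2 * mu).
      by rewrite /X; field; rewrite gt_eqF.
    by rewrite divr_ge0 ?sqr_ge0 ?mulr_ge0 ?ltW.
  have tk : 0 < t k by rewrite divr_gt0 ?sg//= ltnS ltnW.
  have -> : t k.+1 = 2 * c - (t k)^-1.
    by rewrite /t sr invf_div; field; rewrite !gt_eqF ?sg//= ltnS ltnW.
  rewrite big_ord_recr /=; apply: path_step => //.
  exact/IH/ltnW.
have := inv n (leqnn _).
have -> : t n = 0.
  by rewrite /t /a mulrCA divff ?pnatr_eq0// mulr1 sinpi mul0r.
rewrite big_split /= -mulr_sumr => H.
rewrite [X in mu / 2 * X]big_ord_recr /= -subr_ge0.
move: H; set S := \sum_(i < n.+1) (_ + _); set Z := \sum_(i < n.+1) _ => H.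
rewrite subr_ge0; set X := (X in 0 <= X).
have -> : X = S + mu / 2 * Z + d n * z n.+1 - (1 + 0) * d n ^+ 2 / (2 * mu) +
    (mu * z n.+1 - d n) ^+ 2 / (2 * mu).
  by rewrite /X; field; rewrite gt_eqF.
apply: addr_ge0; first by rewrite subr_ge0.
by rewrite divr_ge0 ?sqr_ge0 ?mulr_ge0 ?ltW.
Qed.

Lemma chain_diff_form_ge0 (R : realType) (m n : nat) (M : R)
    (d : 'M[R]_(m.-1, n)) (z : 'M[R]_(m, n)) : (1 < m)%N -> 0 < M ->
  0 <= (1 / M) * (2 + 2 * cos (pi / m%:R)) / 2 * dotmx d d
       + dotmx d (chain_diff z) + M / 2 * dotmx z z.
Proof.
case: m d z => [|[|m]]// d z _ M0.
set L := 1 / M * _; rewrite /dotmx.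
rewrite exchange_big [X in _ + X + _]exchange_big [X in _ + M / 2 * X]exchange_big.
rewrite !mulr_sumr -!big_split; apply: sumr_ge0 => j _ /=.
pose ext p (x : 'M[R]_(p, n)) k := if insub k is Some i then x i j else 0.
have extE p (x : 'M[R]_(p, n)) (i : 'I_p) : ext p x i = x i j by rewrite /ext valK.
have := path_form_ge0 m (ext m.+1 d) (ext m.+2 z) M0.
rewrite -/L [L / 2 * _]mulr_sumr -big_split /=.
congr (0 <= _ + _ * _); apply: eq_bigr => i _; last by rewrite extE expr2.
have zthis := extE _ z (@this m.+2 i); have znext := extE _ z (@Defs.next m.+2 i).
by rewrite mxE extE -znext -zthis expr2.
Qed.

Lemma chain_diffD (R : realType) (m n : nat) (x y : 'M[R]_(m, n)) :
  chain_diff (x + y) = chain_diff x + chain_diff y.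
Proof. by apply/matrixP => i j; rewrite !mxE; ring. Qed.

Lemma row_chain_diff (R : realType) (m n : nat) (x : 'M[R]_(m, n)) i :
  row i (chain_diff x) = row (this i) x - row (Defs.next i) x.
Proof. by apply/rowP => j; rewrite !mxE. Qed.

Lemma enorm_chain_diff (R : realType) (m n : nat) (eps : 'I_m -> R)
    (r : 'M[R]_(m, n)) : (forall i, enorm (row i r) <= eps i) ->
  dotmx (chain_diff r) (chain_diff r) <= total_distortion eps ^+ 2.
Proof.
move=> re; rewrite sqr_sqrtr; last by apply: sumr_ge0 => i _; exact: sqr_ge0.
rewrite dotmx_sum_row; apply: ler_sum => i _.
have e0 k : 0 <= eps k := le_trans (enorm_ge0 _) (re k).
rewrite row_chain_diff -enorm_le ?addr_ge0//.
exact: le_trans (enormB _ _) (lerD (re _) (re _)).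
Qed.

Lemma gradientE (R : realType) (p q : nat) (h : 'M[R]_(p, q) -> R)
    (x G : 'M[R]_(p, q)) (C : R) :
  (forall d, `|h (x + d) - h x - dotmx d G| <= C * dotmx d d) ->
  gradient h x = G.
Proof.
move=> hC; apply/matrixP => i j; rewrite mxE /derive; apply: cvg_lim => //.
have {}hC t : `|h (t *: delta_mx i j + x) - h x - t * G i j| <= C * t ^+ 2.
  rewrite [_ + x]addrC -(dotmx_delta G) -dotmxZl; apply: le_trans (hC _) _.
  by rewrite !dotmxE dotmx_delta mxE !eqxx mulr1 expr2.
have C0 : 0 <= C by have := hC 1; rewrite expr1n mulr1; exact: le_trans (normr_ge0 _).
apply/cvgrPdist_le => e e0; near=> t.
have t0 : t != 0 by near: t; exact: nbhs_dnbhs_neq.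
have te : `|t| <= e / (C + 1).
  by near: t; apply: dnbhs0_le; rewrite divr_gt0// ltr_wpDl.
rewrite -(@ler_pM2l _ `|t|) ?normr_gt0// -normrM mulrBr distrC /=.
rewrite [t * (_ *: _)]mulVKf//; apply: le_trans (hC t) _.
rewrite -real_normK ?num_real// expr2 mulrCA ler_wpM2l//.
apply: le_trans (ler_wpM2l C0 te) _.
by rewrite mulrCA ler_piMr ?(ltW e0)// ler_pdivrMr ?ltr_wpDl// mul1r lerDl.
Unshelve. all: by end_near.
Qed.

Lemma strongly_convex_le (R : realType) (n : nat) (s : R) (f : 'rV[R]_n -> R)
    (x y : 'rV[R]_n) (t : R) : strongly_convex s f -> 0 <= t <= 1 ->
  f (t *: x + (1 - t) *: y) <=
  t * f x + (1 - t) * f y - s / 2 * (t * (1 - t) * dotmx (x - y) (x - y)).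
Proof.
move=> sf t01.
have [t0 t1] := andP t01.
have /= := sf (Itv01 t0 t1) x y (mem_set I) (mem_set I).
rewrite convRE /conv /= /unstable.onem !sqr_enorm !dotmxE (dotmxC y x); lra.
Qed.

Lemma le_limit_factor (R : realFieldType) (a b : R) :
  (forall t, 0 < t < 1 -> (1 - t) * a <= b) -> a <= b.
Proof.
move=> H; have [a0|a0] := lerP a 0.
  apply: le_trans (H (1 / 2) _); lra.
apply/ler_addgt0Pr => e e0; have ae : 0 < a + e by rewrite addr_gt0.
have /H : 0 < e / (a + e) < 1.
  by rewrite divr_gt0//= ltr_pdivrMr// mul1r ltrDr.
suff : e / (a + e) * a <= e by lra.
by rewrite mulrAC ler_pdivrMr// ler_pM2l// lerDl ltW.
Qed.

Section Dual.
Variables (R : realType) (m n : nat) (Y : set 'rV[R]_n).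
Variables (f : 'I_m -> 'rV[R]_n -> R) (mu : 'I_m -> R) (M : R).
Hypotheses (m_gt1 : (1 < m)%N) (Y_convex : convex_set Y).
Hypotheses (f_sc : forall i, strongly_convex (mu i) (f i)).
Hypotheses (M_gt0 : 0 < M) (M_le : forall i, M <= mu i).
Let L := (1 / M) * (2 + 2 * cos (pi / m%:R)).

Lemma lagrangianDl lam d (y : 'M[R]_(m, n)) :
  lagrangian f (lam + d) y = lagrangian f lam y + dotmx d (chain_diff y).
Proof. by rewrite /lagrangian dotmxDl addrA. Qed.

Lemma lagrangian_strongly_convex lam (y z : 'M[R]_(m, n)) t : 0 <= t <= 1 ->
  lagrangian f lam (t *: z + (1 - t) *: y) <=
  t * lagrangian f lam z + (1 - t) * lagrangian f lam y
  - M / 2 * (t * (1 - t) * dotmx (z - y) (z - y)).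
Proof.
move=> t01; rewrite /lagrangian.
have -> : chain_diff (t *: z + (1 - t) *: y) =
    t *: chain_diff z + (1 - t) *: chain_diff y.
  by apply/matrixP => i j; rewrite !mxE; ring.
rewrite [dotmx lam _]dotmxDr !dotmxZr.
suff : \sum_i f i (row i (t *: z + (1 - t) *: y)) <=
    t * \sum_i f i (row i z) + (1 - t) * \sum_i f i (row i y)
    - M / 2 * (t * (1 - t) * dotmx (z - y) (z - y)) by lra.
rewrite dotmx_sum_row !mulr_sumr -sumrN -!big_split /=.
apply: ler_sum => i _; rewrite ![row i (_ + _)]linearD /=.
rewrite ![row i (_ *: _)]linearZ [row i (- _)]linearN /=.
apply: le_trans (strongly_convex_le _ _ (f_sc i) t01) _.
have [t0 t1] := andP t01.
by rewrite lerD2l lerN2 ler_wpM2r ?ler_pM2r// !mulr_ge0 ?subr_ge0 ?dotmx_ge0.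
Qed.

Lemma argmin_growth lam (y z : 'M[R]_(m, n)) :
  argmin (prodset Y) (lagrangian f lam) y -> prodset Y z ->
  lagrangian f lam y + M / 2 * dotmx (z - y) (z - y) <= lagrangian f lam z.
Proof.
move=> [Yy ymin] Yz; rewrite -lerBrDl; apply: le_limit_factor => t /andP[t0 t1].
have t01 : 0 <= t <= 1 by rewrite !ltW.
have Yt : prodset Y (t *: z + (1 - t) *: y).
  move=> i; rewrite linearD !linearZ /=.
  exact: set_mem (Y_convex (Itv01 (ltW t0) (ltW t1))
    (mem_set (Yz i)) (mem_set (Yy i))).
have := le_trans (ymin _ Yt) (lagrangian_strongly_convex lam y z t01).
move=> H; rewrite -(ler_pM2l t0); lra.
Qed.

Lemma dual_le lam d y : argmin (prodset Y) (lagrangian f lam) y ->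
  (dual Y f (lam + d) <= (lagrangian f lam y + dotmx d (chain_diff y))%:E)%E.
Proof.
by move=> [Yy _]; rewrite -lagrangianDl; apply: ereal_inf_lbound; exists y.
Qed.

Lemma dual_ge lam d y : argmin (prodset Y) (lagrangian f lam) y ->
  ((lagrangian f lam y + dotmx d (chain_diff y) - L / 2 * dotmx d d)%:E
   <= dual Y f (lam + d))%E.
Proof.
move=> ymin; apply: le_ereal_inf_tmp => _ [z Yz <-]; rewrite lee_fin lagrangianDl.
have := argmin_growth ymin Yz; have := chain_diff_form_ge0 d (z - y) m_gt1 M_gt0.
rewrite -/L -scaleN1r chain_diffD.
have -> : chain_diff (-1 *: y) = - chain_diff y.
  by apply/matrixP => i j; rewrite !mxE; ring.
rewrite dotmxDr dotmxNr scaleN1r; lra.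
Qed.

Lemma dual_fin_num lam lam' y : argmin (prodset Y) (lagrangian f lam) y ->
  dual Y f lam' \is a fin_num.
Proof.
move=> ymin; rewrite -(subrKC lam lam') fin_numElt.
rewrite (lt_le_trans _ (dual_ge _ ymin)) ?ltNyr//.
by rewrite (le_lt_trans (dual_le _ ymin)) ?ltry.
Qed.

Lemma neg_dual_argmin lam y : argmin (prodset Y) (lagrangian f lam) y ->
  neg_dual Y f lam = - lagrangian f lam y.
Proof.
move=> ymin; rewrite /neg_dual; congr (- _); apply: EFin_inj.
rewrite fineK ?(dual_fin_num _ ymin)//; apply/le_anti.
have := dual_le 0 ymin; have := dual_ge 0 ymin.
by rewrite -(scale0r 0) !dotmxZl !mul0r mulr0 subr0 scale0r !addr0 => -> ->.
Qed.

Lemma neg_dual_bounds lam d y : argmin (prodset Y) (lagrangian f lam) y ->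
  0 <= neg_dual Y f (lam + d) - neg_dual Y f lam + dotmx d (chain_diff y)
    <= L / 2 * dotmx d d.
Proof.
move=> ymin; rewrite (neg_dual_argmin ymin).
have := dual_le d ymin; have := dual_ge d ymin.
rewrite -(fineK (dual_fin_num (lam + d) ymin)) !lee_fin /neg_dual => H1 H2.
apply/andP; split; lra.
Qed.

Lemma gradient_neg_dual lam y : argmin (prodset Y) (lagrangian f lam) y ->
  gradient (neg_dual Y f) lam = - chain_diff y.
Proof.
move=> ymin; apply: (@gradientE _ _ _ _ _ _ (L / 2)) => d.
rewrite dotmxNr [- - dotmx _ _]opprK; have /andP[H1 H2] := neg_dual_bounds d ymin.
by rewrite ger0_norm.
Qed.

Lemma neg_dual_descent lam y (r : 'M[R]_(m, n)) g :
  argmin (prodset Y) (lagrangian f lam) y -> 0 <= g -> g * L <= 1 ->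
  g / 2 * (enorm (gradient (neg_dual Y f) lam) ^+ 2
           - dotmx (chain_diff r) (chain_diff r)) <=
  neg_dual Y f lam - neg_dual Y f (lam + g *: chain_diff (y + r)).
Proof.
move=> ymin g0 gL; rewrite (gradient_neg_dual ymin) enormN sqr_enorm chain_diffD.
set G := chain_diff y; set e := chain_diff r.
have /andP[_ up] := neg_dual_bounds (g *: (G + e)) ymin.
have /(le_trans up) : L / 2 * dotmx (g *: (G + e)) (g *: (G + e)) <=
    g / 2 * dotmx (G + e) (G + e).
  rewrite dotmxZl dotmxZr !mulrA ler_wpM2r ?dotmx_ge0//.
  have := ler_wpM2l g0 gL; lra.
rewrite -/G dotmxZl !dotmxDl !dotmxDr (dotmxC e G); lra.
Qed.
End Dual.

Lemma min_le_sqrt_mean (R : realType) (k : nat) (g a : nat -> R) (D E : R) :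
  (forall i, 0 < g i) -> (forall i, 0 <= a i) -> 0 <= D -> 0 <= E ->
  \sum_(i < k.+1) g i / 2 * (a i ^+ 2 - E ^+ 2) <= D ->
  minI (ltn0Sn k) (fun i : 'I_k.+1 => a i) <=
  Num.sqrt (2 * D / \sum_(i < k.+1) g i) + E.
Proof.
move=> g0 a0 D0 E0 sumD; set mn := minI _ _.
have mn_ge0 : 0 <= mn by exact: le_bigmin.
have mn_le i : mn <= a (i : 'I_k.+1) by exact: bigmin_le.
set S := \sum_(i < _) _ in sumD *.
set G := \sum_(i < _) g i.
have G0 : 0 < G.
  by rewrite /G big_ord_recr /= ltr_wpDl// sumr_ge0// => i _; exact: ltW.
have q0 : 0 <= 2 * D / G by rewrite divr_ge0 ?mulr_ge0// ltW.
rewrite -ler_sqr ?nnegrE ?addr_ge0 ?sqrtr_ge0// sqrrD sqr_sqrtr//.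
have : G * (mn ^+ 2 - E ^+ 2) <= 2 * D.
  apply: (@le_trans _ _ (2 * S)); last by rewrite ler_pM2l.
  rewrite /G mulr_suml mulr_sumr; apply: ler_sum => i _.
  rewrite [leRHS]mulrA [2 * _]mulrC divfK// ler_wpM2l ?(ltW (g0 i))//.
  by rewrite lerB// ler_sqr ?nnegrE.
rewrite mulrC -ler_pdivlMr// => H.
have : 0 <= Num.sqrt (2 * D / G) * E by rewrite mulr_ge0 ?sqrtr_ge0.
lra.
Qed.

Theorem lemma2 (R : realType) (m n : nat) (hm : (2 <= m)%N) (hn : (1 <= n)%N)
    (Y : set 'rV[R]_n) (f : 'I_m -> 'rV[R]_n -> R) (mu eps : 'I_m -> R)
    (lamstar : 'M[R]_(m.-1, n)) (gam : nat -> R) (r : nat -> 'M[R]_(m, n))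
    (lam : nat -> 'M[R]_(m.-1, n)) (y : nat -> 'M[R]_(m, n)) :
  Y !=set0 -> closed Y -> convex_set Y ->
  (forall i, strictly_convex (f i)) ->
  (forall i, closed_function (f i)) ->
  (forall i, 0 < mu i) ->
  (forall i, strongly_convex (mu i) (f i)) ->
  dual_optimal Y f lamstar ->
  inexact_dual Y f gam r lam y ->
  (forall k i, enorm (row i (r k)) <= eps i) ->
  (forall k, 0 < gam k <= 1 / Lh (ltnW hm) mu) ->
  forall k : nat,
    minI (ltn0Sn k) (fun i : 'I_k.+1 => enorm (gradient (neg_dual Y f) (lam i)))
    <= Num.sqrt (2 * (neg_dual Y f (lam 0%N) - neg_dual Y f lamstar)
                 / \sum_(i < k.+1) gam i)
       + total_distortion eps.
Proof.
move=> _ _ Y_convex _ _ mu_gt0 f_sc star_opt alg r_le gam_bd k.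
have M_gt0 : 0 < minI (ltnW hm) mu by exact: lt_bigmin.
have M_le i : minI (ltnW hm) mu <= mu i by exact: bigmin_le.
have y_min i : argmin (prodset Y) (lagrangian f (lam i)) (y i) by have [] := alg i.
have gam0 i : 0 < gam i by have /andP[] := gam_bd i.
have star_le l : neg_dual Y f lamstar <= neg_dual Y f l.
  have fin l' := dual_fin_num hm Y_convex f_sc M_gt0 M_le l' (y_min 0%N).
  by rewrite lerN2 fine_le ?fin.
have L_gt0 : 0 < Lh (ltnW hm) mu.
  have m0 : 0 < m%:R :> R by rewrite ltr0n ltnW.
  rewrite mulr_gt0 ?divr_gt0// ltr_pwDl// mulr_ge0// cos_ge0_pihalf//.
  apply/andP; split.
    by rewrite (@le_trans _ _ 0) ?oppr_le0 ?divr_ge0 ?pi_ge0 ?ltW.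
  by rewrite ler_wpM2l ?pi_ge0// lef_pV2 ?posrE// ler_nat.
apply: (@min_le_sqrt_mean _ k gam (fun i => enorm (gradient (neg_dual Y f) (lam i))))
  => [//|i|||]; rewrite ?subr_ge0 ?sqrtr_ge0//.
apply: (@le_trans _ _ (neg_dual Y f (lam 0%N) - neg_dual Y f (lam k.+1))); last first.
  by rewrite lerD2l lerN2.
have step i : gam i / 2 * (enorm (gradient (neg_dual Y f) (lam i)) ^+ 2
      - total_distortion eps ^+ 2) <= neg_dual Y f (lam i) - neg_dual Y f (lam i.+1).
  have gL : gam i * Lh (ltnW hm) mu <= 1.
    by rewrite -ler_pdivlMr//; have /andP[] := gam_bd i.
  rewrite (proj2 (alg i)).
  apply: le_trans (neg_dual_descent hm Y_convex f_sc M_gt0 M_le (r i)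
    (y_min i) (ltW (gam0 i)) gL).
  apply: ler_wpM2l; first by rewrite divr_ge0// ltW.
  by rewrite lerB// enorm_chain_diff.
elim: k.+1 => [|j IH]; first by rewrite big_ord0 subrr.
by rewrite big_ord_recr /=; have := step j; lra.
Qed.
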